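(* Let $(X,\mathcal{E})$ and $(Y,\mathcal{F})$ be coarse spaces with coarse property C. Then the product coarse space $(X\times Y,\mathcal{E}\ast\mathcal{F})$ has coarse property C.
   Context: Coarse spaces. For a set $X$ and $E,F\subseteq X\times X$, the inverse is $E^{-1}=\{(y,x): (x,y)\in E\}$ and the composition is $E\circ F=\{(x,z): \exists y\in X,\ (x,y)\in E \text{ and } (y,z)\in F\}$. A coarse structure on $X$ is a collection $\mathcal{E}$ of subsets of $X\times X$ that contains the diagonal $\{(x,x):x\in X\}$ and is closed under taking subsets, finite unions, inverses, and compositions. Elements of $\mathcal{E}$ are called entourages, and $(X,\mathcal{E})$ is called a coarse space. Product coarse structure. Let $(X_1,\mathcal{E}_1)$ and $(X_2,\mathcal{E}_2)$ be coarse spaces and let $p_i:X_1\times X_2\to X_i$ be the projections, $i\in\{1,2\}$. The product coarse structure on $X_1\times X_2$ is $$\mathcal{E}_1\ast\mathcal{E}_2=\{E\subseteq (X_1\times X_2)^2 : (p_i\times p_i)(E)\in\mathcal{E}_i \text{ for each } i\in\{1,2\}\}.$$ Coarse property C. A coarse space $(X,\mathcal{E})$ has coarse property C if and only if for any sequence $E_1\subseteq E_2\subseteq\cdots$ of entourages there is a finite sequence $\mathcal{U}_1,\mathcal{U}_2,\ldots,\mathcal{U}_n$ of families of subsets of $X$ satisfying: (1) $\bigcup_{i=1}^n\mathcal{U}_i$ is a cover of $X$; (2) each $\mathcal{U}_i$ is $E_i$-disjoint, i.e., for any pair of distinct elements $U,V$ of $\mathcal{U}_i$ we have $(U\times V)\cap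 E_i=\emptyset$; and (3) each $\mathcal{U}_i$ is uniformly bounded, i.e., $\bigcup_{U\in\mathcal{U}_i}U\times U\in\mathcal{E}$. *)

(* Defs.v *)
From mathcomp Require Import all_boot.
From mathcomp Require Import boolp classical_sets.

Set Implicit Arguments.
Unset Strict Implicit.
Unset Printing Implicit Defensive.

Local Open Scope classical_set_scope.
Local Open Scope relation_scope.

Record coarseStructure (X : Type) := CoarseStructure {
  entourages : set (set (X * X));
  coarse_diagonal : entourages diagonal;
  coarse_subset : forall E F, F `<=` E -> entourages E -> entourages F;
  coarse_setU : forall E F, entourages E -> entourages F ->
    entourages (E `|` F);
  coarse_inv : forall E, entourages E -> entourages E^-1;
  coarse_comp : forall E F, entourages E -> entourages F ->
    entourages (E \; F) }.

Definition product_entourages (X Y : Type)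
    (E : coarseStructure X) (F : coarseStructure Y)
    : set (set ((X * Y) * (X * Y))) :=
  [set G | entourages E [set (g.1.1, g.2.1) | g in G] /\
           entourages F [set (g.1.2, g.2.2) | g in G]].

Section ProductCoarse.
Variables (X Y : Type) (E : coarseStructure X) (F : coarseStructure Y).
Let P := product_entourages E F.

Lemma product_coarse_diagonal : P diagonal.
Proof.
by split; apply: (coarse_subset _ (coarse_diagonal _)) => _ [[p q] /diagonalP -> <-].
Qed.

Lemma product_coarse_subset G H : H `<=` G -> P G -> P H.
Proof.
by move=> HG [G1 G2]; split; [apply: coarse_subset G1|apply: coarse_subset G2];
  exact: image_subset.
Qed.

Lemma product_coarse_setU G H : P G -> P H -> P (G `|` H).
Proof.
by move=> [G1 G2] [H1 H2]; split; rewrite image_setU; exact: coarse_setU.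
Qed.

Lemma product_coarse_inv G : P G -> P G^-1.
Proof.
move=> [/coarse_inv G1 /coarse_inv G2].
by split; [apply: coarse_subset G1|apply: coarse_subset G2];
  move=> _ [[p q] /= Gqp <-]; exists (q, p).
Qed.

Lemma product_coarse_comp G H : P G -> P H -> P (G \; H).
Proof.
move=> [G1 G2] [H1 H2]; split.
  apply: coarse_subset (coarse_comp G1 H1) => _ [[p q] /= [r Gpr Hrq] <-].
  by exists r.1; [exists (p, r)|exists (r, q)].
apply: coarse_subset (coarse_comp G2 H2) => _ [[p q] /= [r Gpr Hrq] <-].
by exists r.2; [exists (p, r)|exists (r, q)].
Qed.

Definition product_coarse : coarseStructure (X * Y) :=
  CoarseStructure product_coarse_diagonal product_coarse_subset
    product_coarse_setU product_coarse_inv product_coarse_comp.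

End ProductCoarse.

Definition rel_disjoint (X : Type) (E : set (X * X)) (U : set (set X)) : Prop :=
  forall A B, U A -> U B -> A <> B -> (A `*` B) `&` E = set0.

Definition uniformly_bounded (X : Type) (E : coarseStructure X)
    (U : set (set X)) : Prop :=
  entourages E (\bigcup_(A in U) (A `*` A)).

(* Sequences are indexed from 0, and only the families [U i] with [i < n]
   matter. *)
Definition coarse_property_C (X : Type) (E : coarseStructure X) : Prop :=
  forall D : nat -> set (X * X),
    (forall i, entourages E (D i)) -> (forall i, D i `<=` D i.+1) ->
  exists (n : nat) (U : nat -> set (set X)),
    [/\ cover (\bigcup_(i < n) U i) id = [set: X],
        forall i, (i < n)%N -> rel_disjoint (D i) (U i) &
        forall i, (i < n)%N -> uniformly_bounded E (U i)].

(* Main.v *)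
Require Import Defs.
From mathcomp Require Import all_boot.
From mathcomp Require Import boolp classical_sets.

(** The products [A `*` B] of a family that is disjoint for the first
projection of [D] and one that is disjoint for the second projection of [D]
form a [D]-disjoint family, so one wants to multiply families of a cover of [X]
with families of a cover of [Y]. The difficulty is one of order: the product
that comes at position [k] has to be [D k]-disjoint, and with a single cover of
[X] the number of products, hence the disjointness asked of its factors, is
only known after both covers have been chosen.

The way out is to take a fresh cover of [X] for every family of the cover of
[Y]. Property C of [X], applied to the sequence [D] shifted by [s], gives a
cover of [X] by [n s] families, the [i]-th of which is disjoint for the
projection of [D (s + i)]. Iterating [s |-> s + n s] from 0 produces block
boundaries [s 0 <= s 1 <= ...], all of them known before [Y] is considered.
Property C of [Y], applied to the projections of [D (s j.+1)], then gives [m]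
families; the [j]-th is multiplied with all families of the cover of [X] that
starts at [s j]. These products fill exactly the positions [k] with
[s j <= k < s j.+1], and both factors are disjoint enough there: the first by
the choice of the shift, the second because [D k `<=` D (s j.+1)]. *)

Set Implicit Arguments.
Unset Strict Implicit.
Unset Printing Implicit Defensive.

Local Open Scope classical_set_scope.

Section ProductFamilies.
Variables X Y : Type.
Implicit Types (D : set ((X * Y) * (X * Y))).
Implicit Types (U : set (set X)) (V : set (set Y)).

Definition fst_rel D : set (X * X) := [set (g.1.1, g.2.1) | g in D].
Definition snd_rel D : set (Y * Y) := [set (g.1.2, g.2.2) | g in D].

Definition prod_family U V : set (set (X * Y)) :=
  [set A `*` B | A in U & B in V].

(** Two distinct products differ in one of their factors, and a pair of [D]
joining them would project to a pair joining these two factors. *)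
Lemma rel_disjoint_prod D U V :
  rel_disjoint (fst_rel D) U -> rel_disjoint (snd_rel D) V ->
  rel_disjoint D (prod_family U V).
Proof.
move=> dU dV _ _ [A UA [B VB <-]] [A' UA' [B' VB' <-]] neq.
rewrite -subset0 => -[p q] [[/= [Ap Bp] [A'q B'q]] Dpq].
have [eA|nA] := EM (A = A').
  have nB : B <> B' by move=> eB; apply: neq; rewrite eA eB.
  rewrite -[False]/(set0 (p.2, q.2)) -(dV _ _ VB VB' nB).
  by split=> //; exists (p, q).
rewrite -[False]/(set0 (p.1, q.1)) -(dU _ _ UA UA' nA).
by split=> //; exists (p, q).
Qed.

Lemma uniformly_bounded_prod (E : coarseStructure X) (F : coarseStructure Y)
    U V :
  uniformly_bounded E U -> uniformly_bounded F V ->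
  uniformly_bounded (product_coarse E F) (prod_family U V).
Proof.
move=> bU bV; split.
  apply: coarse_subset bU => _ [[p q] [_ [A UA [B VB <-]] /= pABq] <-].
  by case: pABq => [[Ap _] [Aq _]]; exists A.
apply: coarse_subset bV => _ [[p q] [_ [A UA [B VB <-]] /= pABq] <-].
by case: pABq => [[_ Bp] [_ Bq]]; exists B.
Qed.

End ProductFamilies.

Lemma rel_disjointS (X : Type) (D D' : set (X * X)) (U : set (set X)) :
  D `<=` D' -> rel_disjoint D' U -> rel_disjoint D U.
Proof.
move=> sDD' dU A B UA UB neq; rewrite -subset0 -(dU A B UA UB neq).
exact: setIS.
Qed.

Lemma subset_seq_homo (T : Type) (D : nat -> set T) :
  (forall i, D i `<=` D i.+1) -> {homo D : i j / (i <= j)%N >-> i `<=` j}.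
Proof.
by move=> incD; apply: homo_leq incD => [A|B A C]; [|exact: subset_trans].
Qed.

(** The blocks [s j, ..., s j.+1 - 1] cut the natural numbers below the supremum
of [s] into consecutive, possibly empty, intervals; [b k] is the number of the
block that contains [k]. *)
Lemma block_index (s : nat -> nat) :
  s 0 = 0 -> (forall j, s j <= s j.+1) ->
  exists b : nat -> nat,
    (forall m k, k < s m -> [/\ b k < m, s (b k) <= k & k < s (b k).+1]) /\
    (forall j k, s j <= k -> k < s j.+1 -> b k = j).
Proof.
move=> s0 incs.
have homs : {homo s : i j / i <= j} by apply: homo_leq => //; exact: leq_trans.
have block_uniq i j k :
    s i <= k -> k < s i.+1 -> s j <= k -> k < s j.+1 -> i = j.
  move=> sik ksi sjk ksj; case: (ltngtP i j) => // /homs le.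
    by have := leq_ltn_trans (leq_trans le sjk) ksi; rewrite ltnn.
  by have := leq_ltn_trans (leq_trans le sik) ksj; rewrite ltnn.
have block_exists m k : k < s m -> exists2 j, j < m & s j <= k < s j.+1.
  elim: m => [|m IHm]; first by rewrite s0.
  have [/IHm[j jm jk] _|smk ksm] := ltnP k (s m); last first.
    by exists m; rewrite ?smk.
  by exists j => //; exact: ltnW.
have /choice[b bP] : forall k, exists i, forall j,
    s j <= k < s j.+1 -> s i <= k < s i.+1.
  move=> k; have [[i ik]|no_block] := EM (exists i, s i <= k < s i.+1).
    by exists i.
  (* [k] lies in no block, as happens when [s] is bounded: any value will do. *)
  by exists 0 => j jk; case: no_block; exists j.
have bE j k : s j <= k -> k < s j.+1 -> b k = j.
  move=> sjk ksj; have /andP[] : s (b k) <= k < s (b k).+1.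
    by apply: (bP k j); rewrite sjk.
  by move=> h1 h2; exact: block_uniq h1 h2 sjk ksj.
exists b; split=> // m k /block_exists[j jm /andP[sjk ksj]].
by rewrite (bE j).
Qed.

(** The next block starts where the cover chosen for the current one ends, so
the number [n s] of its families has to be a function of the shift [s]; this is
where the axiom of choice enters the construction of the blocks. *)
Lemma coarse_property_C_shift (X : Type) (E : coarseStructure X)
    (D : nat -> set (X * X)) :
  coarse_property_C E ->
  (forall i, entourages E (D i)) -> (forall i, D i `<=` D i.+1) ->
  exists (n : nat -> nat) (U : nat -> nat -> set (set X)), forall s,
    [/\ cover (\bigcup_(i < n s) U s i) id = [set: X],
        forall i, (i < n s)%N -> rel_disjoint (D (s + i)) (U s i) &
        forall i, (i < n s)%N -> uniformly_bounded E (U s i)].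
Proof.
move=> hE ED incD.
have shift_cover s : exists nU : nat * (nat -> set (set X)),
    [/\ cover (\bigcup_(i < nU.1) nU.2 i) id = [set: X],
        forall i, (i < nU.1)%N -> rel_disjoint (D (s + i)) (nU.2 i) &
        forall i, (i < nU.1)%N -> uniformly_bounded E (nU.2 i)].
  have [||n [U UP]] := hE (fun i => D (s + i)); last by exists (n, U).
    by move=> i; exact: ED.
  by move=> i; rewrite addnS; exact: incD.
have [nU nUP] := choice shift_cover.
by exists (fun s => (nU s).1), (fun s => (nU s).2).
Qed.

Theorem theorem2p1 (X Y : Type) (E : coarseStructure X) (F : coarseStructure Y)
    (hE : coarse_property_C E) (hF : coarse_property_C F) :
  coarse_property_C (product_coarse E F).
Proof.
move=> D PD incD.
have [n [U UP]] : exists (n : nat -> nat) (U : nat -> nat -> set (set X)),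
    forall s, [/\ cover (\bigcup_(i < n s) U s i) id = [set: X],
      forall i, (i < n s)%N -> rel_disjoint (fst_rel (D (s + i))) (U s i) &
      forall i, (i < n s)%N -> uniformly_bounded E (U s i)].
  apply: (coarse_property_C_shift (D := fun i => fst_rel (D i))) => // i.
    by have [] := PD i.
  exact: image_subset.
pose s j := iter j (fun t => t + n t) 0.
have sS j : s j.+1 = s j + n (s j) by [].
have incs j : s j <= s j.+1 by rewrite sS leq_addr.
have [||m [V [covV disV bndV]]] := hF (fun j => snd_rel (D (s j.+1))).
- by move=> j; have [] := PD (s j.+1).
- by move=> j; apply: image_subset; exact: (subset_seq_homo incD).
have [b [bP bE]] := block_index (erefl : s 0 = 0) incs.
exists (s m), (fun k => prod_family (U (s (b k)) (k - s (b k))) (V (b k))).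
have offset_lt k : k < s m -> k - s (b k) < n (s (b k)).
  by move=> /bP[_ sbk]; rewrite sS ltn_subLR.
split.
- rewrite -subTset => -[x y] _.
  have : [set: Y] y by [].
  rewrite -covV => -[B [j jm VB] By].
  have [covU _ _] := UP (s j); have : [set: X] x by [].
  rewrite -covU => -[A [i iN UA] Ax].
  have bk : b (s j + i) = j by apply: bE; rewrite ?leq_addr// sS ltn_add2l.
  exists (A `*` B) => //; exists (s j + i).
    apply: (@leq_trans (s j.+1)); first by rewrite sS ltn_add2l.
    by apply: (homo_leq (@leqnn) (@leq_trans) incs).
  by rewrite bk addKn; exists A => //; exists B.
- move=> k km; have [bm sbk ksb] := bP _ _ km; have [_ disU _] := UP (s (b k)).
  apply: rel_disjoint_prod.
    by rewrite -{1}(subnKC sbk); exact: disU (offset_lt _ km).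
  apply: rel_disjointS (disV _ bm); apply: image_subset.
  by apply: (subset_seq_homo incD); exact: ltnW.
- move=> k km; have [bm _ _] := bP _ _ km; have [_ _ bndU] := UP (s (b k)).
  exact: uniformly_bounded_prod (bndU _ (offset_lt _ km)) (bndV _ bm).
Qed.
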